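(* Let $G$ be a finite group and $p$ a fixed prime divisor of $|G|$. Then every non-nilpotent subgroup of $G$ is a TI-subgroup of $G$ or subnormal in $G$ or has $p'$-order if and only if one of the following statements holds: (1) every non-nilpotent subgroup of $G$ of order divisible by $p$ is subnormal in $G$; (2) $p>2$ and $G=(Z_q)^r\rtimes(Z_p\rtimes H)$ is a Frobenius group with kernel $(Z_q)^r$ and complement $Z_p\rtimes H$, where $q$ is a prime with $q\neq p$ and $r>1$, $Z_p$ is a Sylow $p$-subgroup of $G$, $H$ is either a cyclic group or a direct product of the quaternion group $Q_8$ and a cyclic group of odd order such that $[Z_p,H]\neq 1$, and $Z_p$ acts irreducibly (by conjugation) on $(Z_q)^r$.
   Context: All groups are finite. A subgroup $H$ of a group $G$ is a TI-subgroup of $G$ if for every $g\in G$, $H^g\cap H=1$ or $H^g\cap H=H$. A subgroup has $p'$-order if its order is not divisible by $p$. $Z_n$ denotes the cyclic group of order $n$, $(Z_q)^r$ the elementary abelian group of order $q^r$, and $Q_8$ the quaternion group of order $8$. *)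

(* Defs.v *)
From mathcomp Require Import all_boot all_fingroup all_solvable.
Set Implicit Arguments. Unset Strict Implicit. Unset Printing Implicit Defensive.
Local Open Scope group_scope.

Definition TI_subgroup (gT : finGroupType) (H G : {set gT}) : Prop :=
  forall g, g \in G -> (H :^ g :&: H = 1) \/ (H :^ g :&: H = H).

(* Main.v *)
(** For the direct implication, let [M] be of largest order among the
non-nilpotent, non-subnormal subgroups of [G] of order divisible by [p]. It is
TI, and self-normalising by maximality, so Frobenius' theorem makes it the
complement of a Frobenius kernel [K]. A subnormal subgroup containing an element
[x] with ['C_K[x] = 1] contains [K]; hence a subgroup [L A], with [1 < L < K]
and [A] a complement of [K] normalising [L], would contradict the choice of [M].
Applied to Sylow subgroups of [K] (through the Frattini argument) and to
['Ohm_1('Z(K))], this makes [K] an elementary abelian [q]-group. The hypothesis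
on the groups [L A] with [A] of order [p] in [M] then shows that [A] acts
irreducibly on [K], so by Schur's lemma ['C_M(A)] is abelian, and abelian
subgroups of [M] are cyclic since they act semiregularly on [K]. The subgroups
[K A] are subnormal, so [M] has a normal Sylow [p]-subgroup [P]; the TI property
of the subgroups [A B], with [A] in [P] and [B] in a complement [H] of [P] in
[M], forces [#|P| = p] and makes every subgroup of [H] normal. A Dedekind group
whose abelian subgroups are cyclic is cyclic or the product of ['Q_8] with a
cyclic group of odd order.

Conversely, a subgroup [X] of order divisible by [p] contains, up to conjugacy,
[P]; by irreducibility it meets [K] in [1], and then lies in ['N_G(P) = M] and
is TI, or it contains [K], and is then normal. *)

Require Import Defs.
From mathcomp Require Import all_boot all_fingroup all_solvable.
From mathcomp Require Import mxrepresentation mxabelem vcharacter.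
Set Implicit Arguments.
Unset Strict Implicit.
Unset Printing Implicit Defensive.
Local Open Scope group_scope.

Section TISubnormal.
Variable gT : finGroupType.
Implicit Types (A B C G H K L M N P Q X Y : {group gT}).

(** * Fixed-point-free elements and subnormal subgroups *)

(* The map [k |-> [~ x, k]] from [K] to itself is injective, hence onto, and its
   values lie in [N]. *)
Lemma normal_sub_fpf K N x :
  x \in 'N(K) -> 'C_K[x] = 1 -> x \in N -> K \subset 'N(N) -> K \subset N.
Proof.
move=> nKx regKx Nx nNK; pose f k := [~ x, k].
have fK: f @: K \subset K.
  apply/subsetP=> _ /imsetP[k Kk ->]; rewrite /f commgEr groupMr //.
  by rewrite memJ_norm ?groupV.
have injf: {in K &, injective f}.
  move=> k l Kk Kl; rewrite /f /commg => /mulgI eq_xkl.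
  apply/eqP; rewrite eq_mulgV1 -in_set1 -set1gE -regKx inE groupMl // groupV Kl.
  rewrite cent1C /=; apply/cent1P/commgP.
  by rewrite /commg conjgM eq_xkl conjgK mulVg.
have <-: f @: K = K by apply/eqP; rewrite eqEcard fK (card_in_imset injf) /=.
apply/subsetP=> _ /imsetP[k Kk ->].
by rewrite /f /commg groupMl ?groupV // memJ_norm // (subsetP nNK).
Qed.

(** Descend a subnormal chain from [G] to [X]: once a term contains [K], the next term is normalised
    by [K], and [normal_sub_fpf] applies to it. *)
Lemma subnormal_sub_fpf K G X x :
  x \in 'N(K) -> 'C_K[x] = 1 -> x \in X -> X <|<| G -> K \subset G ->
  K \subset X.
Proof.
move=> nKx regKx Xx /subnormalP[s]; elim: s X Xx => [|Y s IHs] X Xx /=.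
  by move=> _ <-.
case/andP=> /andP[sXY nXY] snY defG sKG.
have sKY := IHs _ (subsetP sXY _ Xx) snY defG sKG.
exact: normal_sub_fpf nKx regKx Xx (subset_trans sKY nXY).
Qed.

(** By induction [P] is normal in the chain term below [G], so it is the [p]-core of that term, a
    characteristic subgroup. *)
Lemma subnormal_Sylow_normal p P G : p.-Sylow(G) P -> P <|<| G -> P <| G.
Proof.
move=> sylP /subnormalP[s]; elim/last_ind: s G sylP => [|s Y IHs] G sylP /=.
  by move=> _ ->; apply: normal_refl.
rewrite rcons_path last_rcons => /andP[sn nY] defY; subst Y.
have sPL: P \subset last P s.
  by apply: subnormal_sub; apply/subnormalP; exists s.
have sylPL := pHall_subl sPL (normal_sub nY) sylP.
have nsP := IHs _ sylPL sn erefl.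
rewrite -(normal_Hall_pcore sylPL nsP).
exact: gFnormal_trans.
Qed.

Lemma card2_norm_cent P H : #|P| = 2 -> H \subset 'N(P) -> H \subset 'C(P).
Proof.
move=> oP nPH; have /cards1P[z defz]: #|P^#| == 1%N.
  by have:= cardsD1 1 P; rewrite oP group1 add1n => -[<-].
have P1 x : x \in P^# -> x = z by rewrite defz => /set1P.
rewrite centsC; apply/centsP=> x Px h Hh.
have [->|ntx] := eqVneq x 1; first exact: commute_sym (commute1 h).
have P1x: x \in P^# by rewrite in_setD Px andbT in_set1.
apply/commgP/conjg_fixP; rewrite [RHS](P1 x) // (P1 (x ^ h)) //.
by rewrite memJ_norm // (subsetP _ h Hh) // normD1.
Qed.

(** * Semiregular and irreducible actions on abelian groups *)

(** Semiregularity makes [A] faithful on a minimal [A]-invariant subgroup of [K]; an abelian group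
    with a faithful irreducible representation is cyclic. *)
Lemma semiregular_abelian_cyclic q K A :
  q.-abelem K -> K :!=: 1 -> A \subset 'N(K) -> semiregular K A -> abelian A ->
  cyclic A.
Proof.
move=> abelK ntK nKA regKA cAA.
have [E minE sEK] := minnormal_exists ntK nKA.
have [/andP[ntE nEA] _] := mingroupP minE.
have abelE := abelemS sEK abelK.
have Eirr := elimT (abelem_mx_irrP abelE ntE nEA) minE.
apply: mx_faithful_irr_abelian_cyclic Eirr cAA.
apply: abelem_mx_faithful; apply: cent_semiregular sEK ntE.
exact: semiregular_sym.
Qed.

(* An instance of Schur's lemma: over the ring of endomorphisms of [K] that
   commute with [C], which contains the action of [P], any nontrivial element of
   [K] generates [K]; hence every element of [C] acts as a member of that ring. *)
Lemma irr_cent_abelian K P C :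
    abelian K -> acts_irreducibly P K 'J -> C \subset 'N(K) ->
    P \subset C -> C \subset 'C(P) -> 'C_C(K) = 1 -> abelian C.
Proof.
move=> cKK /mingroupP[/andP[ntK]]; rewrite astabsJ => nKP minK nKC sPC cPC fC.
pose E (f : gT -> gT) := [/\ {in K, forall u, f u \in K},
  {in K &, {morph f : u v / u * v}} &
  {in K & C, forall u c, f (u ^ c) = f u ^ c}].
have KJ u c : c \in C -> u \in K -> u ^ c \in K.
  by move=> Cc Ku; rewrite memJ_norm ?(subsetP nKC).
have KP u c : c \in P -> u \in K -> u ^ c \in K.
  by move=> Cc Ku; rewrite memJ_norm ?(subsetP nKP).
have [v Kv ntv] := trivgPn _ ntK.
have min (T : {set gT}) : group_set T -> v \in T -> T \subset K ->
    {in T & P, forall u x, u ^ x \in T} -> K \subset T.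
  move=> gT_ Tv sTK TJ; rewrite -[T]/(gval (Group gT_)) (minK (Group gT_)) //.
  apply/andP; split; first by apply/trivgPn; exists v.
  rewrite astabsJ; apply/subsetP=> x Px; rewrite inE.
  by apply/subsetP=> _ /imsetP[u Tu ->]; apply: TJ.
have Egen c : c \in C -> exists2 f, E f & {in K, forall u, f u = u ^ c}.
  (* [F] is a boolean form of [E] on a finite type of functions, so that the values at [v] form a
     finite set [T]. *)
  move=> Cc; pose F (g : {ffun gT -> gT}) := 
    [&& [forall u in K, g u \in K],
        [forall u in K, forall w in K, g (u * w) == g u * g w] &
        [forall u in K, forall d in C, g (u ^ d) == g u ^ d]].
  have FP (g : {ffun gT -> gT}) : reflect (E g) (F g).
    apply: (iffP and3P) => [[]|[h1 h2 h3]].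
      move=> /forall_inP h1 /forall_inP h2 /forall_inP h3.
      split=> // [u w Ku Kw|u d Ku Cd].
        by have /forall_inP/(_ _ Kw)/eqP := h2 u Ku.
      by have /forall_inP/(_ _ Cd)/eqP := h3 u Ku.
    split; apply/forall_inP=> u Ku; first exact: h1.
      by apply/forall_inP=> w Kw; apply/eqP/h2.
    by apply/forall_inP=> d Cd; apply/eqP/h3.
  pose T := [set g v | g : {ffun gT -> gT} in F].
  have TE (g : gT -> gT) : E g -> g v \in T.
    move=> [h1 h2 h3]; apply/imsetP.
    exists [ffun u => g u]; last by rewrite ffunE.
    apply/FP; split=> [u Ku|u w Ku Kw|u d Ku Cd]; rewrite !ffunE.
    - exact: h1.
    - exact: h2.
    - exact: h3.
  have sKT: K \subset T.
    apply: min.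
    - apply/group_setP; split.
        apply: (TE (fun=> 1)); split=> [u _|u w _ _|u d _ _] /=;
          by rewrite ?group1 ?mulg1 ?conj1g.
      move=> _ _ /imsetP[g /FP[g1 g2 g3] ->] /imsetP[h /FP[h1 h2 h3] ->].
      apply: (TE (fun u => g u * h u)); split=> [u Ku|u w Ku Kw|u d Ku Cd].
      + by rewrite groupM ?g1 ?h1.
      + rewrite g2 // h2 // !mulgA; congr (_ * _).
        rewrite -!mulgA; congr (_ * _).
        by apply: (centsP cKK); rewrite ?g1 ?h1.
      + by rewrite g3 // h3 // conjMg.
    - by apply: (TE id); split.
    - by apply/subsetP=> _ /imsetP[g /FP[g1 _ _] ->]; apply: g1.
    move=> _ x /imsetP[g /FP[g1 g2 g3] ->] Px.
    apply: (TE (fun u => g u ^ x)); split=> [u Ku|u w Ku Kw|u d Ku Cd].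
    + by rewrite KP ?g1.
    + by rewrite g2 // conjMg.
    + by rewrite g3 // -!conjgM (centsP cPC d Cd x Px).
  have /imsetP[f /FP Ef vc] := subsetP sKT _ (KJ _ _ Cc Kv).
  exists f => //; have [f1 f2 f3] := Ef.
  (* [f] and conjugation by [c] agree at [v], and the points where they agree form a [P]-stable
     subgroup. *)
  suffices /subsetP sKf: K \subset [set u in K | f u == u ^ c].
    by move=> u /sKf; rewrite inE => /andP[_ /eqP].
  have f_1: f 1 = 1 by apply: (mulgI (f 1)); rewrite -f2 ?mulg1.
  apply: min.
  - apply/group_setP; split; first by rewrite inE group1 f_1 conj1g eqxx.
    move=> u w /[!inE] /andP[Ku /eqP fu] /andP[Kw /eqP fw].
    by rewrite groupM // f2 // fu fw conjMg eqxx.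
  - by rewrite inE Kv vc eqxx.
  - by apply/subsetP=> u /[!inE] /andP[].
  move=> u x /[!inE] /andP[Ku /eqP fu] Px.
  rewrite KP // f3 ?(subsetP sPC) // fu -!conjgM.
  by rewrite (centsP cPC c Cc x Px) eqxx.
apply/centsP=> c Cc d Cd; apply/commgP.
rewrite -in_set1 -set1gE -fC inE groupR //=.
(* [c] acts on [K] as [f], which commutes with the action of [d]; so [[~ c, d]] centralises [K]. *)
have [f [_ _ f3] fc] := Egen c Cc.
have swap u : u \in K -> u ^ (c * d) = u ^ (d * c).
  by move=> Ku; rewrite !conjgM -!fc ?KJ // f3.
apply/centP=> u Ku; apply/esym/commgP/conjg_fixP.
have Kw: u ^ (d * c)^-1 \in K by rewrite KJ ?groupV ?groupM.
by rewrite -[u in LHS](conjgKV (d * c)) -[LHS]conjgM -commgC swap // conjgKV.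
Qed.


(** * Dedekind groups *)

Lemma Dedekind_nilpotent H :
  (forall A, A \subset H -> A <| H) -> nilpotent H.
Proof.
move=> nsH; rewrite (_ : H :=: 'F(H)) ?Fitting_nil //.
apply/eqP; rewrite eqEsubset Fitting_sub andbT; apply/subsetP=> x Hx.
rewrite -cycle_subG Fitting_max ?nsH ?cycle_subG //.
by rewrite abelian_nil ?cycle_abelian.
Qed.

(** The normal subgroup [<[y]>] contains [[~ y, x] = x ^+ 2], so [y] both centralises and inverts
    [x ^+ 2]; thus [x ^+ 4 = 1], while [x] has order [2 ^ n.-1]. *)
Lemma Dedekind_quaternion_8 Q n :
    (forall A, A \subset Q -> A <| Q) -> n > 2 -> Q \isog 'Q_(2 ^ n) ->
  Q \isog 'Q_8.
Proof.
move=> nsQ n_gt2 isoQ; have [[x y] genQ _] := generators_quaternion n_gt2 isoQ.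
have [[_ oX' xV] _ _ _ _] := quaternion_structure n_gt2 genQ isoQ.
have [oQ Qx ox Q'y] := genQ; have [Qy X'y] := setDP Q'y.
have [oy yx] := (oX' y Q'y, xV x y (cycle_id x) Q'y).
suff n3: n = 3 by rewrite n3 in isoQ.
apply/eqP; rewrite eqn_leq n_gt2 andbT.
have Yx2: x ^+ 2 \in <[y]>.
  have nYx: x \in 'N(<[y]>).
    by apply: (subsetP (normal_norm (nsQ _ _))) => //; rewrite cycle_subG.
  have <-: [~ y, x] = x ^+ 2 by rewrite commgEr conjVg yx invgK.
  by rewrite commgEl groupMl ?groupV ?cycle_id // memJ_norm ?cycle_id.
have x2V: x ^+ 2 = (x ^+ 2)^-1.
  rewrite -expgVn -yx -conjXg conjgE.
  have /cycleP[i ->] := Yx2; by rewrite -expgSr expgS mulKg.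
have: #[x] %| (2 * 2)%N by rewrite order_dvdn expgM expgS {2}x2V expg1 mulgV.
move/dvdn_leq; rewrite ox -[(2 * 2)%N]/(2 ^ 2)%N leq_exp2l // => /(_ isT).
by rewrite -ltnS prednK // (leq_trans _ n_gt2).
Qed.

(** In a [p]-subgroup the subgroups of order [p] are normal, hence central, and generate an
    elementary abelian, thus cyclic, group. So there is at most one, and the [p]-subgroup is cyclic
    or quaternion. *)
Lemma rank1_Dedekind H :
    (forall A, A \subset H -> A <| H) ->
    (forall A, A \subset H -> abelian A -> cyclic A) ->
  cyclic H \/ exists Q C,
    [/\ Q \x C = H, Q \isog 'Q_8, cyclic C & odd #|C|].
Proof.
move=> nsH cycH; have nilH := Dedekind_nilpotent nsH.
have cycR (p : nat) (R : {group gT}) :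
    p.-group R -> R \subset H -> cyclic R \/ p = 2 /\ R \isog 'Q_8.
  move=> pR sRH.
  have [R1|ntR] := eqsVneq R 1; first by left; rewrite R1 cyclic1.
  have [p_pr p_dv_R _] := pgroup_pdiv pR ntR.
  suff /(prime_Ohm1P pR ntR)/orP[|/andP[/eqP p2]]: #|'Ohm_1(R)| = p.
  - by left.
  - move/eqP/quaternion_classP=> [n n_gt2 isoR]; right; split=> //.
    apply: Dedekind_quaternion_8 n_gt2 isoR => A sAR.
    exact: normalS sAR sRH (nsH A (subset_trans sAR sRH)).
  have sR1Z: 'Ohm_1(R) \subset 'Z(R).
    rewrite (Ohm1Eprime R) gen_subG; apply/subsetP=> x /[!inE] /andP[Rx x_pr].
    have sXR: <[x]> \subset R by rewrite cycle_subG.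
    have nsX: <[x]> <| R := normalS sXR sRH (nsH _ (subset_trans sXR sRH)).
    have ntX: <[x]> != 1 by rewrite -cardG_gt1 prime_gt1.
    have := meet_center_nil (pgroup_nil pR) nsX ntX.
    by move/(prime_meetG x_pr); rewrite cycle_subG => /setIP[_ ->]; rewrite Rx.
  have cR1: abelian 'Ohm_1(R) := abelianS sR1Z (center_abelian R).
  apply: cyclic_abelem_prime.
  - by rewrite abelem_Ohm1.
  - by rewrite cycH // (subset_trans (Ohm_sub 1 R)).
  - by rewrite Ohm1_eq1.
have [Q sylQ] := Sylow_exists 2 H; have [sQH qQ _] := and3P sylQ.
have [cQ|[_ isoQ]] := cycR 2 Q qQ sQH.
  left; apply: nil_Zgroup_cyclic nilH.
  apply/forall_inP=> V /SylowP[p p_pr sylV].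
  have [sVH pV _] := and3P sylV.
  have [//|[p2 _]] := cycR p V pV sVH; subst p.
  by have [x _ ->] := Sylow_trans sylQ sylV; rewrite cyclicJ.
right; exists Q, 'O_2^'(H)%G.
have defQ := nilpotent_Hall_pcore nilH sylQ.
have oddC: odd #|'O_2^'(H)| by rewrite odd_2'nat [_.-nat _]pcore_pgroup.
split=> //; first by rewrite /= defQ nilpotent_pcoreC.
apply: nil_Zgroup_cyclic (nilpotentS (pcore_sub _ _) nilH).
apply/forall_inP=> V /SylowP[p p_pr /and3P[sVC pV _]].
have [//|[_ isoV]] := cycR p V pV (subset_trans sVC (pcore_sub _ _)).
by have := oddSg sVC oddC; rewrite (card_isog isoV) (@card_quaternion 3).
Qed.

(** A nontrivial subgroup contains the only involution, which generates the derived subgroup. *)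
Lemma Q8_Dedekind Q A : Q \isog 'Q_8 -> A \subset Q -> A <| Q.
Proof.
move=> isoQ sAQ; have n_gt2: 2 < 3 by [].
have [[x y] genQ _] := generators_quaternion n_gt2 isoQ.
have [_ [defQ' _ _ _] [_ _ unz _ _] _ _] :=
  quaternion_structure n_gt2 genQ isoQ.
have [->|ntA] := eqsVneq A 1; first exact: normal1.
apply: (sub_der1_normal _ sAQ).
have qQ: 2.-group Q by rewrite /pgroup (card_isog isoQ) (@card_quaternion 3).
have [_ /Cauchy[//|t At ot] _] := pgroup_pdiv (pgroupS sAQ qQ) ntA.
have := unz t (subsetP sAQ t At) ot.
rewrite defQ' cycle_subG /= => <- //.
Qed.

(** [A] is the product of its [2]-part, in [Q], and its odd part, in the central factor [C]; each is
    normal in [H]. *)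
Lemma dprod_Q8_cyclic_Dedekind H Q C A :
  Q \x C = H -> Q \isog 'Q_8 -> cyclic C -> odd #|C| -> A \subset H -> A <| H.
Proof.
move=> defH isoQ cycC oddC sAH.
have oQ: #|Q| = 8 by rewrite (card_isog isoQ) (@card_quaternion 3).
have [_ defQC cQC tiQC] := dprodP defH.
have [nsQH nsCH] := dprod_normal2 defH.
have qQ: 2.-group Q by rewrite /pgroup oQ.
have q'C: 2^'.-group C by rewrite /pgroup -odd_2'nat.
have [hallQ hallC] := coprime_mulpG_Hall defQC qQ q'C.
have nilH: nilpotent H.
  by rewrite (dprod_nil defH) (pgroup_nil qQ) abelian_nil ?cyclic_abelian.
have /dprodW defA := nilpotent_pcoreC 2 (nilpotentS sAH nilH).
have sAQ: 'O_2(A) \subset Q.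
  rewrite (sub_normal_Hall hallQ nsQH) ?pcore_pgroup //.
  exact: subset_trans (pcore_sub _ _) sAH.
have sAC: 'O_2^'(A) \subset C.
  rewrite (sub_normal_Hall hallC nsCH) ?pcore_pgroup //.
  exact: subset_trans (pcore_sub _ _) sAH.
rewrite -defA normalM // /normal.
  rewrite (subset_trans sAQ (normal_sub nsQH)) -defQC mul_subG //.
    exact: normal_norm (Q8_Dedekind isoQ sAQ).
  by rewrite cents_norm // (subset_trans cQC) // centS.
rewrite (subset_trans sAC (normal_sub nsCH)) -defQC mul_subG // cents_norm //.
  by rewrite centsC (subset_trans sAC).
by rewrite centsC (subset_trans sAC) // -abelianE cyclic_abelian.
Qed.


(** * TI-subgroups, and the subgroups [L <*> A] of a Frobenius group *)

Lemma TI_norm X G A :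
  TI_subgroup X G -> A :!=: 1 -> A \subset X -> 'N_G(A) \subset 'N(X).
Proof.
move=> tiX ntA sAX; apply/subsetP=> g /setIP[Gg nAg].
have [tiXg|/setIidPr sXXg] := tiX g Gg; last by rewrite -groupV inE sub_conjgV.
case/negP: ntA; rewrite -subG1 -tiXg subsetI sAX andbT.
by rewrite -(normP nAg) conjSg.
Qed.

Lemma Frobenius_cent_compl G K A :
    [Frobenius G with kernel K] -> A \subset G -> A :&: K = 1 ->
  semiregular K A.
Proof.
case/Frobenius_kerP=> _ _ _ regK sAG tiAK x /setD1P[ntx Ax].
apply/trivgP/subsetP=> y /setIP[Ky cxy]; apply: contraR ntx => nty.
rewrite -in_set1 -set1gE -tiAK inE Ax (subsetP (regK y _)) //.
  by rewrite in_setD nty.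
by rewrite inE (subsetP sAG) // cent1C.
Qed.

(** [A] acts semiregularly on [L], so their orders are coprime; nilpotency would make them
    commute. *)
Lemma Frobenius_join_nonnil G K A L :
    [Frobenius G with kernel K] -> A \subset G -> A :&: K = 1 -> A :!=: 1 ->
    L \subset K -> L :!=: 1 -> A \subset 'N(L) ->
  ~~ nilpotent (L <*> A).
Proof.
move=> frobG sAG tiAK ntA sLK ntL nLA.
have regKA := Frobenius_cent_compl frobG sAG tiAK.
have regLA := semiregularS sLK (subxx A) regKA.
apply: contra ntL => nilLA.
have := sub_nilpotent_cent2 nilLA (joing_subl L A) (joing_subr L A).
move/(_ (regular_norm_coprime nLA regLA)); rewrite centsC => /setIidPl <-.
by rewrite (cent_semiregular regLA).
Qed.

(** A nontrivial element of [A] acts without fixed points on [K], so [K \subset L <*> A]; the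
    modular law gives [(L <*> A) :&: K = L]. *)
Lemma Frobenius_join_ker G K A L :
    [Frobenius G with kernel K] -> A \subset G -> A :&: K = 1 -> A :!=: 1 ->
    L \subset K -> A \subset 'N(L) ->
  L <*> A <|<| G \/ K \subset 'N(L <*> A) -> L :=: K.
Proof.
move=> frobG sAG tiAK ntA sLK nLA snLA.
have regKA := Frobenius_cent_compl frobG sAG tiAK.
have [_ _ /andP[sKG nKG] _] := Frobenius_kerP frobG.
have [x Ax ntx] := trivgPn _ ntA.
have nKx: x \in 'N(K) by rewrite (subsetP nKG) ?(subsetP sAG).
have regx: 'C_K[x] = 1 by rewrite regKA // !inE ntx.
have LAx: x \in L <*> A by rewrite (subsetP (joing_subr L A)).
have sKLA: K \subset L <*> A.
  case: snLA => sn; first exact: subnormal_sub_fpf nKx regx LAx sn sKG.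
  exact: normal_sub_fpf nKx regx LAx sn.
apply/eqP; rewrite eqEsubset sLK -{1}(setIidPl sKLA) norm_joinEr //.
by rewrite setIC -group_modl // tiAK mulg1 /=.
Qed.

(** * A largest non-subnormal subgroup and its Frobenius kernel *)

Lemma maximal_nonsubnormal_Frobenius G (p : nat) X :
    (forall Y, Y \subset G -> ~~ nilpotent Y -> p %| #|Y| ->
       TI_subgroup Y G \/ Y <|<| G) ->
    X \subset G -> ~~ nilpotent X -> p %| #|X| -> ~~ (X <|<| G) ->
  exists K M, [/\ [Frobenius G = K ><| M], ~~ nilpotent M, p %| #|M| &
    forall Y, Y \subset G -> ~~ nilpotent Y -> #|M| %| #|Y| -> #|M| < #|Y| ->
      Y <|<| G].
Proof.
move=> hG sXG nilX pX snX.
pose bad (Y : {group gT}) :=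
  [&& Y \subset G, ~~ nilpotent Y, p %| #|Y| & ~~ (Y <|<| G)].
have badX: bad X by apply/and4P.
case: (arg_maxnP (fun Y : {group gT} => #|Y|) badX) => M.
case/and4P=> sMG nilM pM snM maxM.
have tiM: TI_subgroup M G by case: (hG M) => // snM'; rewrite snM' in snM.
have ntM: M :!=: 1 by apply: contraNneq nilM => ->; apply: nilpotent1.
have defN: 'N_G(M) = M.
  (* ['N_G(M)] is again [bad]: if it were subnormal, so would be [M], which is normal in it. *)
  apply/eqP; rewrite eq_sym eqEcard subsetI sMG normG /=.
  have sMN: M \subset 'N_G(M) by rewrite subsetI sMG normG.
  apply: maxM; apply/and4P; split; first exact: subsetIl.
  - by apply: contra nilM; apply: nilpotentS.
  - exact: dvdn_trans pM (cardSg sMN).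
  apply: contra snM; apply: subnormal_trans; apply: normal_subnormal.
  exact: normalSG.
have frobM: [Frobenius G with complement M].
  apply/andP; split.
    by apply: contraNneq snM => ->; apply: subnormal_refl.
  apply/normedTI_P; split; first by rewrite setD_eq0 subG1.
    by rewrite normD1 defN.
  move=> g Gg /pred0Pn[x /andP[/setD1P[ntx Mx]]].
  rewrite /= conjD1g => /setD1P[_ Mgx]; rewrite -defN inE Gg.
  have [ti|/setIidPr sMMg] := tiM g Gg; last by rewrite -groupV inE sub_conjgV.
  by case/negP: ntx; rewrite -in_set1 -set1gE -ti inE Mgx.
have [K frobG] := Frobenius_kernel_exists frobM.
exists K, M; split=> // Y sYG nilY dvMY ltMY.
apply: contraLR ltMY => snY; rewrite -leqNgt; apply: maxM; apply/and4P.
by split=> //; apply: dvdn_trans pM dvMY.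
Qed.

Lemma maximal_nonsubnormal_ker G K M :
    [Frobenius G = K ><| M] ->
    (forall Y, Y \subset G -> ~~ nilpotent Y -> #|M| %| #|Y| -> #|M| < #|Y| ->
      Y <|<| G) ->
  exists2 q : nat, prime q & q.-abelem K.
Proof.
move=> frobG maxM; have frobK := FrobeniusWker frobG.
have [defG ntK ntM _ _] := Frobenius_context frobG.
have [nsKG sMG _ nKM tiKM] := sdprod_context defG; have [sKG nKG] := andP nsKG.
(* [A] ranges over all complements of [K], as the one that normalises a Sylow subgroup need not be
   [M]. *)
have minK A L : A \subset G -> A :&: K = 1 -> #|A| = #|M| -> L \subset K ->
    L :!=: 1 -> A \subset 'N(L) -> L :=: K.
  move=> sAG tiAK oA sLK ntL nLA.
  have ntA: A :!=: 1 by rewrite -cardG_gt1 oA cardG_gt1.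
  apply: (Frobenius_join_ker frobK sAG tiAK ntA sLK nLA); left.
  have oY: #|L <*> A| = (#|L| * #|M|)%N.
    have tiLA: L :&: A = 1 by apply/trivgP; rewrite /= setIC -tiAK setIS.
    by rewrite /= norm_joinEr // TI_cardMg // oA.
  apply: maxM; rewrite ?oY ?dvdn_mull ?ltn_Pmull ?cardG_gt1 ?cardG_gt0 //.
    by rewrite join_subG (subset_trans sLK).
  exact: Frobenius_join_nonnil frobK sAG tiAK ntA sLK ntL nLA.
have [/eqP|[q q_pr q_dvK]] := trivgVpdiv K; first by rewrite (negPf ntK).
exists q => //.
have [S sylS] := Sylow_exists q K; have [sSK qS _] := and3P sylS.
have ntS: S :!=: 1.
  rewrite -cardG_gt1 (card_Hall sylS) p_part_gt1.
  by rewrite mem_primes q_pr cardG_gt0.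
(* [N] covers [G / K], so Schur-Zassenhaus in [N] yields a complement of [K] that normalises [S]. *)
have defKN := Frattini_arg nsKG sylS; set N := 'N_G(S) in defKN.
have defNK: 'N_K(S) = K :&: N by rewrite setIA (setIidPl sKG).
have nsNK: K :&: N <| N by rewrite setIC (normalGI (subsetIl G _) nsKG).
have iNK: #|N : K :&: N| = #|M|.
  rewrite setIC indexgI -indexMg defKN -divgS // -(sdprod_card defG).
  by rewrite mulKn ?cardG_gt0.
have hallNK: Hall N (K :&: N).
  rewrite /Hall subsetIr iNK (coprimeSg (subsetIl _ _)) //.
  exact: Frobenius_coprime frobG.
have /splitsP[A /complP[tiA defN]] := SchurZassenhaus_split hallNK nsNK.
have [_ sAN] := mulG_sub defN.
have [sAG nSA] := subsetIP sAN.
have tiAK: A :&: K = 1.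
  by rewrite -(setIidPr sAN) setIAC -setIA setICA setIA tiA.
have oA: #|A| = #|M|.
  apply/eqP; rewrite -(eqn_pmul2l (cardG_gt0 (K :&: N))) -TI_cardMg // defN.
  by rewrite -iNK Lagrange ?subsetIr.
have defK := minK A S sAG tiAK oA sSK ntS nSA.
have qK: q.-group K by rewrite -defK.
have ntZ: 'Ohm_1('Z(K)) != 1.
  by rewrite Ohm1_eq1 center_nil_eq1 ?(pgroup_nil qK).
have sZK: 'Ohm_1('Z(K)) \subset K.
  by rewrite (subset_trans (Ohm_sub _ _)) ?center_sub.
rewrite -(minK M 'Ohm_1('Z(K))%G) ?[M :&: K]setIC //=.
  by rewrite Ohm1_abelem ?center_abelian // (pgroupS (center_sub K)).
by rewrite !gFnorm_trans.
Qed.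


(** * Structure of the Frobenius complement *)

Lemma Frobenius_compl_structure G K M (p q : nat) :
    prime p ->
    (forall Y, Y \subset G -> ~~ nilpotent Y -> p %| #|Y| ->
       TI_subgroup Y G \/ Y <|<| G) ->
    [Frobenius G = K ><| M] -> q.-abelem K -> ~~ nilpotent M -> p %| #|M| ->
  exists P H, [/\ P ><| H = M, p.-Sylow(M) P & #|P| = p] /\
    [/\ cyclic H \/ exists Q C,
          [/\ Q \x C = H, Q \isog 'Q_8, cyclic C & odd #|C|],
        [~: P, H] != 1 & acts_irreducibly P K 'J].
Proof.
move=> p_pr hG frobG abelK nilM p_dvM; have frobK := FrobeniusWker frobG.
have [defG ntK ntM _ _] := Frobenius_context frobG.
have [nsKG sMG _ nKM tiKM] := sdprod_context defG; have [sKG nKG] := andP nsKG.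
have regKM := Frobenius_reg_ker frobG; have cKK := abelem_abelian abelK.
have sub A : A \subset M -> p %| #|A| ->
    [/\ A \subset G, A :&: K = 1 & A :!=: 1].
  move=> sAM p_dvA; split; first exact: subset_trans sMG.
    by apply/trivgP; rewrite -tiKM /= setIC setIS.
  apply: contraTneq p_dvA => ->.
  by rewrite cards1 dvdn1 neq_ltn (prime_gt1 p_pr) orbT.
have TI_or_subnormal A L :
    A \subset M -> p %| #|A| -> L \subset K -> L :!=: 1 -> A \subset 'N(L) ->
    TI_subgroup (L <*> A) G \/ L <*> A <|<| G.
  move=> sAM p_dvA sLK ntL nLA; have [sAG tiAK ntA] := sub A sAM p_dvA.
  apply: hG; first by rewrite join_subG (subset_trans sLK).
    exact: Frobenius_join_nonnil frobK sAG tiAK ntA sLK ntL nLA.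
  exact: dvdn_trans p_dvA (cardSg (joing_subr _ _)).
(* If [L <*> A] is TI, the abelian group [K] normalises [L], hence [L <*> A]; so
   [Frobenius_join_ker] covers both alternatives. *)
have irr A : A \subset M -> p %| #|A| -> acts_irreducibly A K 'J.
  move=> sAM p_dvA; have [sAG tiAK ntA] := sub A sAM p_dvA.
  apply/mingroupP; rewrite ntK astabsJ (subset_trans sAM) //; split=> // L.
  rewrite astabsJ => /andP[ntL nLA] sLK.
  apply: (Frobenius_join_ker frobK sAG tiAK ntA sLK nLA).
  have [tiY|] := TI_or_subnormal A L sAM p_dvA sLK ntL nLA; last by left.
  right; apply: subset_trans (TI_norm tiY ntL (joing_subl _ _)).
  by rewrite subsetI sKG sub_abelian_norm.
have cycM A : A \subset M -> abelian A -> cyclic A.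
  move=> sAM; apply: (semiregular_abelian_cyclic abelK ntK).
    exact: subset_trans nKM.
  exact: semiregularS (subxx _) sAM regKM.
have cent_abel A : A \subset M -> p %| #|A| -> abelian A -> abelian 'C_M(A).
  move=> sAM p_dvA cAA; have irrA := irr A sAM p_dvA.
  apply: (irr_cent_abelian cKK irrA).
  - exact: subset_trans (subsetIl _ _) nKM.
  - by rewrite subsetI sAM.
  - exact: subsetIr.
  have regMK := semiregular_sym regKM; apply/trivgP.
  rewrite -(cent_semiregular regMK (subxx K) ntK).
  by rewrite setSI ?subsetIl.
(* [K <*> A] is subnormal in either case, since being TI and containing the normal subgroup [K]
   makes it normal; intersect it with [M]. *)
have snM A : A \subset M -> p %| #|A| -> A <|<| M.
  move=> sAM p_dvA; have [sAG tiAK ntA] := sub A sAM p_dvA.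
  have nKA := subset_trans sAM nKM.
  have defA: (K <*> A) :&: M = A.
    by rewrite norm_joinEr // setIC -group_modr // setIC tiKM mul1g.
  rewrite -{1}defA; apply: setI_subnormal sMG _.
  have [tiY|//] := TI_or_subnormal A K sAM p_dvA (subxx K) ntK nKA.
  apply: normal_subnormal; rewrite /normal join_subG sKG sAG.
  apply: subset_trans (TI_norm tiY ntK (joing_subl _ _)).
  by rewrite subsetI subxx.
have nsM A X : A <| M -> A :!=: 1 -> A \subset X -> X \subset M ->
    ~~ nilpotent X -> p %| #|X| -> X <| M.
  move=> nsAM ntA sAX sXM nilX p_dvX; have [sXG tiXK ntX] := sub X sXM p_dvX.
  rewrite /normal sXM; have [tiX|snX] := hG X sXG nilX p_dvX.
    apply: subset_trans (TI_norm tiX ntA sAX).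
    by rewrite subsetI sMG normal_norm.
  (* Subnormality is impossible here: it would put [K] inside [X], hence inside [M]. *)
  have [x Xx ntx] := trivgPn _ ntX; have Mx := subsetP sXM x Xx.
  case/negP: ntK; rewrite -subG1 -tiKM subsetI subxx (subset_trans _ sXM) //.
  apply: (subnormal_sub_fpf _ _ Xx snX sKG); first exact: (subsetP nKM).
  by rewrite regKM // !inE ntx.
have [P sylP] := Sylow_exists p M; have [sPM pP _] := and3P sylP.
have p_dvP: p %| #|P|.
  rewrite (card_Hall sylP) -{1}(expn1 p) pfactor_dvdn // logn_part.
  by rewrite -pfactor_dvdn // expn1.
have nsPM := subnormal_Sylow_normal sylP (snM P sPM p_dvP).
have [_ _ ntP] := sub P sPM p_dvP.
have ntZ: 'Z(P) != 1 by rewrite center_nil_eq1 ?(pgroup_nil pP).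
have [_ /Cauchy[//|x Zx ox] _] := pgroup_pdiv (pgroupS (center_sub P) pP) ntZ.
(* [P] lies in the abelian group ['C_M(P0)], so it is cyclic and [P0] is characteristic in it. *)
have [Px cPx] := setIP Zx; pose P0 := <[x]>%G.
have oP0: #|P0| = p by rewrite -ox.
have sP0P: P0 \subset P by rewrite cycle_subG.
have sP0M := subset_trans sP0P sPM.
have p_dvP0: p %| #|P0| by rewrite oP0.
have [_ _ ntP0] := sub P0 sP0M p_dvP0.
have cC0 := cent_abel P0 sP0M p_dvP0 (cycle_abelian x).
have cPP0: P \subset 'C(P0) by rewrite centsC cycle_subG.
have cPP: abelian P by apply: abelianS cC0; rewrite subsetI sPM.
have cycP := cycM P sPM cPP.
have nsP0M: P0 <| M by apply: char_normal_trans nsPM; rewrite sub_cyclic_char.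
have hallP := pHall_Hall sylP.
have /splitsP[H /complP[tiPH defPH]] := SchurZassenhaus_split hallP nsPM.
have [_ sHM] := mulG_sub defPH.
have nPH := subset_trans sHM (normal_norm nsPM).
have defM: P ><| H = M by rewrite sdprodE.
have coPH: coprime #|P| #|H| by rewrite (coprime_sdprod_Hall_l defM).
have ncP0H: ~~ (H \subset 'C(P0)).
  apply: contra nilM => cP0H; apply: abelian_nil.
  by apply: abelianS cC0; rewrite subsetI subxx -defPH mul_subG.
have nonnilX A B :
    A \subset P -> B \subset H -> ~~ (B \subset 'C(A)) ->
  ~~ nilpotent (A <*> B).
  move=> sAP sBH; apply: contra => nilAB.
  apply: sub_nilpotent_cent2 nilAB (joing_subl _ _) (joing_subr _ _) _.
  by rewrite (coprimeSg sAP) ?(coprimegS sBH).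
have oP: #|P| = p.
  pose X := (P0 <*> H)%G.
  have nsXM: X <| M.
    apply: (nsM P0) => //; rewrite ?joing_subl ?join_subG ?sP0M ?nonnilX //.
    exact: dvdn_trans p_dvP0 (cardSg (joing_subl _ _)).
  have nP0H := subset_trans sHM (normal_norm nsP0M).
  have defP0: P :&: X = P0.
    by rewrite /= norm_joinEr // setIC -group_modl // [H :&: P]setIC tiPH mulg1.
  (* [H] normalises [P], and [P] normalises [X], so the commutators lie in [P :&: X]. *)
  have RP0 z h : z \in P -> h \in H -> [~ z, h] \in P0.
    move=> Pz Hh; rewrite -defP0 inE commgEl groupMl ?groupV //.
    rewrite memJ_norm ?(subsetP nPH) // Pz -commgEl commgEr.
    have Xh: h \in X by rewrite (subsetP (joing_subr _ _)).
    rewrite groupMr // memJ_norm ?groupV //.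
    by rewrite (subsetP (normal_norm nsXM)) ?(subsetP sPM).
  (* If P0 != P, every element of P0 is a p-th power z ^+ p with z \in P, so
     [~ z ^+ p, h] = [~ z, h] ^+ p = 1 and H centralises P0. *)
  apply: contraNeq ncP0H => neP; apply/centsP=> h Hh y P0y.
  have [n oPn] := p_natP pP; have [g defP] := cyclicP cycP.
  have n_gt1: 1 < n.
    rewrite ltn_neqAle eq_sym -(eqn_exp2l _ _ (prime_gt1 p_pr)) -oPn neP /=.
    by rewrite -(ltn_exp2l _ _ (prime_gt1 p_pr)) -oPn cardG_gt1.
  have defP0': P0 :=: <[g ^+ (p ^ n.-1)]>.
    apply/eqP; rewrite (eq_subG_cyclic cycP) //; last first.
      by rewrite cycle_subG groupX // defP cycle_id.
    have og: #[g] = (p * p ^ n.-1)%N.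
      by rewrite orderE -defP oPn -expnS prednK // ltnW.
    rewrite oP0 -orderE orderXdiv og ?dvdn_mull //.
    by rewrite mulnK ?expn_gt0 ?prime_gt0.
  have /cycleP[i def_y]: y \in <[g ^+ (p ^ n.-1)]> by rewrite -defP0'.
  (* As [1 < n], the predecessors are not truncated: [p ^ n.-2 * p = p ^ n.-1], whence
     [z ^+ p = y]. *)
  pose z := g ^+ (p ^ n.-2 * i).
  have Pz: z \in P by rewrite groupX // defP cycle_id.
  have {def_y} ->: y = z ^+ p.
    rewrite def_y -!expgM mulnAC -expnSr prednK //.
    by rewrite -ltnS prednK // ltnW.
  apply/commute_sym/commgP; rewrite commXg.
    by rewrite -oP0 expg_cardG ?RP0.
  by apply: (centsP cPP) => //; rewrite (subsetP sP0P) ?RP0.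
have ncPH: ~~ (H \subset 'C(P)).
  by apply: contra ncP0H => /subset_trans->; rewrite ?centS.
exists P, H; split; first by [].
split; last exact: irr; last first.
  by apply: contra ncPH => /eqP/commG1P; rewrite centsC.
apply: rank1_Dedekind => A sAH; have sAM := subset_trans sAH sHM;
  last exact: cycM.
(* Either [A] lies in the cyclic normal subgroup ['C_M(P)] of [M], or [P <*> A] is non-nilpotent,
   hence normal in [M], and meets [H] in [A]. *)
have [cPA|ncPA] := boolP (A \subset 'C(P)).
  apply: normalS sAH sHM _.
  have cC := cent_abel P sPM p_dvP cPP.
  have cycC := cycM _ (subsetIl _ _) cC.
  apply: char_normal_trans (_ : 'C_M(P) <| M); last first.
    by rewrite /normal subsetIl normsI ?normG ?norms_cent ?normal_norm.
  by rewrite sub_cyclic_char // subsetI sAM.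
have nsXM: P <*> A <| M.
  apply: (nsM P) => //; rewrite ?joing_subl ?join_subG ?sPM ?nonnilX //.
  exact: dvdn_trans p_dvP (cardSg (joing_subl _ _)).
have <-: H :&: (P <*> A) = A.
  rewrite norm_joinEr ?(subset_trans sAH) // -group_modr //.
  by rewrite [H :&: P]setIC tiPH mul1g.
exact: normalGI sHM nsXM.
Qed.

(** * Converse: subgroups of order divisible by [p] are TI or normal *)

Lemma TI_subgroupJ X G g : g \in G -> TI_subgroup (X :^ g) G -> TI_subgroup X G.
Proof.
move=> Gg tiX h Gh; have := tiX (h ^ g) (groupJ Gh Gg).
have ->: (X :^ g) :^ (h ^ g) :&: X :^ g = (X :^ h :&: X) :^ g.
  by rewrite -conjsgM -conjgC conjsgM conjIg.
case=> [/(canRL (conjsgK g))|/conjsg_inj]; last by right.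
by rewrite conjs1g; left.
Qed.

Lemma Frobenius_irr_TI_or_normal G K M P H X (p : nat) :
    prime p -> [Frobenius G = K ><| M] -> P ><| H = M -> p.-Sylow(G) P ->
    #|P| = p -> (forall A, A \subset H -> A <| H) -> acts_irreducibly P K 'J ->
    X \subset G -> p %| #|X| ->
  TI_subgroup X G \/ X <| G.
Proof.
move=> p_pr frobG defM sylP oP nsH irrP sXG /Cauchy[//|x Xx ox].
have [g Gg sPX]: exists2 g, g \in G & P \subset X :^ g.
  have [] := Sylow_subJ sylP (_ : <[x]> \subset G) (_ : p.-group <[x]>).
  - by rewrite cycle_subG (subsetP sXG).
  - by rewrite /pgroup -orderE ox pnat_id.
  move=> g Gg sxP; exists g^-1; first by rewrite groupV.
  rewrite -sub_conjg; suff <-: <[x]> = P :^ g by rewrite cycle_subG.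
  by apply/eqP; rewrite eqEcard sxP cardJg oP -orderE ox leqnn.
(* Both conclusions are invariant under conjugation in [G], so [X] may be assumed to contain [P]. *)
suff main Y : P \subset Y -> Y \subset G -> TI_subgroup Y G \/ Y <| G.
  have [//||tiX|nsX] := main (X :^ g)%G; first by rewrite -(conjGid Gg) conjSg.
    by left; apply: TI_subgroupJ Gg tiX.
  by right; rewrite -(normalJ _ _ g) (conjGid Gg).
move=> {x ox X Xx sXG g Gg} {}sPX sXG; rename Y into X.
have [defG ntK ntM _ _] := Frobenius_context frobG.
have [nsKG sMG defKM nKM tiKM] := sdprod_context defG.
have [nsPM sHM defPH nPH tiPH] := sdprod_context defM.
have [[sKG nKG] [sPM nPM]] := (andP nsKG, andP nsPM).
have nsM A : P \subset A -> A \subset M -> A <| M.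
  move=> sPA sAM; have defA: P * (H :&: A) = A.
    by rewrite group_modl // defPH (setIidPr sAM).
  rewrite /normal sAM -defPH mul_subG ?(subset_trans sPA) ?normG //.
  rewrite -defA normsM //; exact: normal_norm (nsH _ (subsetIl _ _)).
have [/andP[_ nKP] minK] := mingroupP irrP; rewrite astabsJ in nKP.
have [tiXK|ntXK] := eqVneq (X :&: K) 1.
  left; have [_ /normedTI_P[_ _ tiM]] := andP (FrobeniusWcompl frobG).
  have ntP: P :!=: 1 by rewrite -cardG_gt1 oP prime_gt1.
  have nsKPG: K <*> P <| G.
    rewrite /normal join_subG sKG (subset_trans sPM) //= -defKM mul_subG //.
      by rewrite (subset_trans (joing_subl K P)) ?normG.
    by rewrite normsY.
  (* [P] is the intersection of [X] with the normal subgroup [K <*> P] of [G]. *)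
  have nsPX: P <| X.
    have <-: X :&: (K <*> P) = P.
      by rewrite norm_joinEr // -group_modr // tiXK mul1g.
    exact: normalGI sXG nsKPG.
  have tiMM g0 : g0 \in G -> M :^ g0 :&: M != 1 -> g0 \in M.
    move=> Gg0 /trivgPn[y /setIP[Mgy My] nty]; apply: tiM => //.
    by apply/pred0Pn; exists y; rewrite /= conjD1g !inE nty My Mgy.
  (* For [y] in [X], both [M] and [M :^ y] contain [P], which forces [y] into [M]. *)
  have sXM: X \subset M.
    apply/subsetP=> y Xy; apply: tiMM; first exact: (subsetP sXG).
    apply: contraNneq ntP => tiMy; rewrite -subG1 -tiMy subsetI sPM andbT.
    by rewrite -(normsP (normal_norm nsPX) y Xy) conjSg.
  move=> y Gy; have [My|M'y] := boolP (y \in M).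
    by right; rewrite (normsP (normal_norm (nsM X sPX sXM)) y My) setIid.
  left; apply/trivgP; apply: contraR M'y; rewrite subG1 => ntXy.
  apply: tiMM => //; apply: contraNneq ntXy => tiMy.
  by rewrite -subG1 -tiMy setISS ?conjSg.
right; have sKX: K \subset X.
  rewrite -(minK (X :&: K)%G) ?subsetIl ?subsetIr // ntXK astabsJ.
  by rewrite normsI // (subset_trans sPX) ?normG.
have defX: K * (M :&: X) = X by rewrite group_modl // defKM (setIidPr sXG).
rewrite /normal sXG -defKM mul_subG ?(subset_trans sKX) ?normG //.
rewrite -defX normsM // normal_norm // nsM ?subsetIl //.
by rewrite subsetI sPM.
Qed.

End TISubnormal.

(** * Assembling both directions and the numerical conditions *)

Theorem theorem1p2 (gT : finGroupType) (G : {group gT}) (p : nat) :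
  prime p -> (p %| #|G|)%N ->
  (forall X : {group gT}, X \subset G -> ~~ nilpotent X ->
     [\/ TI_subgroup X G, X <|<| G | ~~ (p %| #|X|)%N])
  <->
  ((forall X : {group gT}, X \subset G -> ~~ nilpotent X ->
      (p %| #|X|)%N -> X <|<| G)
   \/
   (2 < p /\
    exists q r : nat, exists K P H M : {group gT},
      [/\ prime q, q != p, 1 < r, q.-abelem K & #|K| = (q ^ r)%N] /\
      [/\ K ><| M = G, P ><| H = M, [Frobenius G = K ><| M],
          P \in 'Syl_p(G) & #|P| = p] /\
      [/\ cyclic H \/
            (exists Q C : {group gT},
               [/\ Q \x C = H, Q \isog 'Q_8, cyclic C & odd #|C|]),
          [~: P, H] != 1
        & acts_irreducibly P K 'J])).
Proof.
move=> p_pr _; split=> [hG|[hG X sXG nilX|[_ dataG] X sXG nilX]]; last first.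
- have [q [r [K [P [H [M [_ [defsG [defH _ irrP]]]]]]]]] := dataG.
  have [_ defM frobG sylP oP] := defsG.
  have [p_dvX|] := boolP (p %| #|X|)%N; last by constructor 3.
  rewrite inE in sylP.
  have nsH (A : {group gT}) : A \subset H -> A <| H.
    move=> sAH; case: defH => [cycH|[Q [C [defH isoQ cycC oddC]]]].
      by rewrite -sub_abelian_normal ?cyclic_abelian.
    exact: dprod_Q8_cyclic_Dedekind defH isoQ cycC oddC sAH.
  have [|nsX] :=
    Frobenius_irr_TI_or_normal p_pr frobG defM sylP oP nsH irrP sXG p_dvX.
    by constructor 1.
  by constructor 2; apply: normal_subnormal.
- have [p_dvX|] := boolP (p %| #|X|)%N; last by constructor 3.
  by constructor 2; apply: hG.
pose bad (X : {group gT}) :=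
  [&& X \subset G, ~~ nilpotent X, p %| #|X| & ~~ (X <|<| G)].
have [/existsP[X]|/existsPn noX] := boolP [exists X, bad X]; last first.
  left=> X sXG nilX p_dvX; move: (noX X).
  by rewrite /bad sXG nilX p_dvX negbK.
case/and4P=> sXG nilX p_dvX snX.
have {}hG (Y : {group gT}) : Y \subset G -> ~~ nilpotent Y -> p %| #|Y| ->
    TI_subgroup Y G \/ Y <|<| G.
  move=> sYG nilY p_dvY.
  by case: (hG Y sYG nilY); [left | right | rewrite p_dvY].
right.
have [K [M [frobG nilM p_dvM maxM]]] :=
  maximal_nonsubnormal_Frobenius hG sXG nilX p_dvX snX.
have [q q_pr abelK] := maximal_nonsubnormal_ker frobG maxM.
have [P [H [[defM sylP oP] [defH ntPH irrP]]]] :=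
  Frobenius_compl_structure p_pr hG frobG abelK nilM p_dvM.
have [defG ntK ntM _ _] := Frobenius_context frobG.
have [nsKG sMG _ nKM tiKM] := sdprod_context defG.
have [qK cKK _] := and3P abelK.
have [r oK] := p_natP qK.
have p'K: coprime p #|K|.
  by rewrite coprime_sym (coprime_dvdr p_dvM) ?(Frobenius_coprime frobG) //.
have r_gt0: 0 < r by case: r oK => // /eqP; rewrite -trivg_card1 (negPf ntK).
have p'natK: (#|K|`_p)%N = 1%N.
  by rewrite part_p'nat // p'natE // -prime_coprime.
have sylPG: p.-Sylow(G) P.
  by rewrite pHallE (subset_trans (pHall_sub sylP)) // (card_Hall sylP)
    -(sdprod_card defG) partnM ?cardG_gt0 // p'natK mul1n /=.
split.
  rewrite ltn_neqAle prime_gt1 // andbT; apply: contraNneq ntPH => p2.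
  have [_ _ _ nPH _] := sdprod_context defM.
  by apply/eqP/commG1P; rewrite centsC card2_norm_cent // oP.
exists q, r, K, P, H, M; split; first split=> //.
- apply: contraTneq p'K => <-.
  by rewrite oK coprime_pexpr // prime_coprime // dvdnn.
- rewrite ltn_neqAle r_gt0 andbT; apply: contraNneq nilM => r1.
  rewrite -r1 expn1 in oK; rewrite abelian_nil //.
  (* On a group of prime order even the trivial group acts irreducibly, so [irr_cent_abelian] with
     [P] trivial makes [M] abelian. *)
  have irr1: acts_irreducibly 1 K 'J.
    apply/mingroupP; rewrite ntK sub1G; split=> // L /andP[ntL _] sLK.
    by apply/eqP; rewrite eqEsubset sLK prime_meetG ?oK // (setIidPr sLK).
  apply: (irr_cent_abelian cKK irr1 nKM (sub1G M)); first by rewrite cents1.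
  exact: cent_semiregular (Frobenius_reg_compl frobG) (subxx K) ntK.
by split; split=> //; rewrite inE.
Qed.
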